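(* For $q,y\ge0$ let $$M^*(q,y):=\max\bigl(q,\ 1,\ 1+\theta(y-1),\ q+\theta(1+y-2q)\bigr).$$ Consider the following conditions on a map $E:\mathbb{R}_+^2\to\mathbb{R}_+$: $$\begin{aligned}\text{(a)}\quad&E(q,z)\le E(q,y)\le E(q,z)+\theta(y-z)&&\text{for }0\le z\le y,\\ \text{(b)}\quad&E(q,y)\le\max\bigl(E(1+y-q,y),\,q,\,1,\,1+y-q\bigr)&&\text{for }0\le q\le y+1,\\ \text{(c)}\quad&E(q,y)\le\max(q,1)&&\text{for }y\le\max(0,q-1),\\ \text{(d)}\quad&E(q,y)\le y&&\text{for }y=\max(q,1).\end{aligned}$$ Then the map $M^*:\mathbb{R}_+^2\to\mathbb{R}_+$ satisfies (a)–(d). Moreover, any map $E:\mathbb{R}_+^2\to\mathbb{R}_+$ that satisfies (a)–(d) also satisfies $E(q,y)\le M^*(q,y)$ for all $q,y\ge0$.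
   Context: $\mathbb{R}_+=[0,\infty)$. $\theta=\sup_{q\in\mathbb{N}}\theta_q$ with $\theta_q=\sqrt{\max(0,1-4\lambda_1(q))}$, where $\lambda_1(q)$ is the smallest positive eigenvalue of the hyperbolic Laplacian for $\Gamma_0(q)$; it is known that $0\le\theta\le7/32<1/2$. *)

(* Defs.v *)
From HB Require Import structures.
From mathcomp Require Import all_boot all_order all_algebra.
From mathcomp Require Import complex.
From mathcomp Require Import all_classical all_reals all_analysis.

Set Implicit Arguments.
Unset Strict Implicit.
Unset Printing Implicit Defensive.

Import Order.TTheory GRing.Theory Num.Theory.
Import numFieldNormedType.Exports.

Local Open Scope classical_set_scope.
Local Open Scope ring_scope.
Local Open Scope complex_scope.

Section Spectrum.
Context {R : realType}.

Definition upper_half_plane : set R[i] := [set z | 0 < complex.Im z].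

Definition Gamma0 (q : nat) : set 'M[int]_2 :=
  [set g | \det g = 1 /\ (q%:Z %| g 1%R 0%R)%Z].

Definition mobius (g : 'M[int]_2) (z : R[i]) : R[i] :=
  ((g 0 0)%:~R * z + (g 0 1)%:~R) / ((g 1 0)%:~R * z + (g 1 1)%:~R).

Definition partial_x (u : R -> R -> R) (x y : R) : R := derive1 (u ^~ y) x.
Definition partial_y (u : R -> R -> R) (x y : R) : R := derive1 (u x) y.

(* C^k on the upper half-plane {y > 0}.  The differentiability clauses are
   needed because [derive1] is a total operator. *)
Fixpoint Ck (k : nat) (u : R -> R -> R) : Prop :=
  (forall x y : R, 0 < y -> {for (x, y), continuous (fun p : R * R => u p.1 p.2)}) /\
  if k is k'.+1 then
    [/\ forall x y : R, 0 < y -> derivable (u ^~ y) x 1 /\ derivable (u x) y 1,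
        Ck k' (partial_x u) & Ck k' (partial_y u)]
  else True.

Definition hyperbolic_laplacian (u : R -> R -> R) (x y : R) : R :=
  - y ^+ 2 * (partial_x (partial_x u) x y + partial_y (partial_y u) x y).

(* A strict fundamental domain: every orbit meets F in exactly one point. *)
Definition fundamental_domain (q : nat)
    (F : set (measurableTypeR R * measurableTypeR R)) : Prop :=
  [/\ measurable F,
      forall p, F p -> 0 < p.2 &
      forall z, upper_half_plane z ->
        exists! p, F p /\ exists2 g, Gamma0 q g & mobius g z = p.1 +i* p.2].

(* Square-integrability on Gamma_0(q) \ H for dx dy / y^2. *)
Definition square_integrable (q : nat) (f : R[i] -> R[i]) : Prop :=
  exists2 F, fundamental_domain q F &
  (\int[lebesgue_measure \x lebesgue_measure]_(p in F)
     ((complex.Re (f (p.1 +i* p.2)) ^+ 2 + complex.Im (f (p.1 +i* p.2)) ^+ 2)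
        / p.2 ^+ 2)%:E < +oo)%E.

(* The Laplacian is real, so it acts on the real and imaginary parts of f
   separately.  By elliptic regularity the L^2 eigenfunctions are smooth, so
   classical (C^2) eigenfunctions suffice.  Its eigenvalues are real since it
   is self-adjoint. *)
Definition is_eigenvalue (q : nat) (lambda : R) : Prop :=
  exists f : R[i] -> R[i],
    let u x y := complex.Re (f (x +i* y)) in
    let v x y := complex.Im (f (x +i* y)) in
    [/\ exists2 z, upper_half_plane z & f z != 0,
        forall g z, Gamma0 q g -> upper_half_plane z -> f (mobius g z) = f z,
        square_integrable q f,
        Ck 2 u /\ Ck 2 v &
        forall x y, 0 < y -> hyperbolic_laplacian u x y = lambda * u x y /\
                             hyperbolic_laplacian v x y = lambda * v x y].

(* The infimum is attained: the L^2 eigenvalues for Gamma_0(q) form an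
   infinite discrete subset of [0, +oo). *)
Definition lambda1 (q : nat) : R :=
  inf [set lambda | 0 < lambda /\ is_eigenvalue q lambda].

Definition theta_ (q : nat) : R := Num.sqrt (Num.max 0 (1 - 4 * lambda1 q)).

End Spectrum.

Definition theta (R : realType) : R :=
  sup [set theta_ q | q in [set q : nat | (0 < q)%N]].

Section Conditions.
Context {R : realType}.
Implicit Types (t : R) (E : R -> R -> R).

(* A map R_+^2 -> R_+ is represented by a function R -> R -> R, of which only
   the values at nonnegative arguments matter. *)
Definition nonneg_map E : Prop :=
  forall q y, 0 <= q -> 0 <= y -> 0 <= E q y.

Definition Mstar t (q y : R) : R :=
  Num.max q (Num.max 1 (Num.max (1 + t * (y - 1)) (q + t * (1 + y - 2 * q)))).

Definition cond_a t E : Prop := forall q y z, 0 <= q -> 0 <= z -> z <= y ->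
  E q z <= E q y /\ E q y <= E q z + t * (y - z).

Definition cond_b E : Prop := forall q y, 0 <= y -> 0 <= q -> q <= y + 1 ->
  E q y <= Num.max (E (1 + y - q) y) (Num.max q (Num.max 1 (1 + y - q))).

Definition cond_c E : Prop := forall q y, 0 <= q -> 0 <= y ->
  y <= Num.max 0 (q - 1) -> E q y <= Num.max q 1.

Definition cond_d E : Prop := forall q y, 0 <= q -> 0 <= y ->
  y = Num.max q 1 -> E q y <= y.

Definition conds_ad t E : Prop :=
  [/\ cond_a t E, cond_b E, cond_c E & cond_d E].

End Conditions.

(* Main.v *)
Require Import Defs.
From mathcomp Require Import all_boot all_order all_algebra.
From mathcomp Require Import all_classical all_reals all_analysis.
From mathcomp Require Import lra.

Import Order.TTheory GRing.Theory Num.Theory.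
Local Open Scope ring_scope.

(** Write [t] for [theta R]; the argument is elementary for every real
    [t] in [0, 1/2].

    Each of the four terms of [Mstar] is affine in [y] with slope 0 or [t], so
    (a) holds.  With [q' = 1 + y - q] the last term is [q + t * (q' - q)], a
    convex combination of [q] and [q'], and the third term does not depend on
    [q], which gives (b); (c) and (d) are direct comparisons.

    For the maximality of [Mstar], let [E] satisfy (a)-(d).  When [q <= 1], (d)
    bounds [E] at [y = 1] and (a) carries the bound to every [y].  When
    [1 <= q], the same works from the diagonal [y = 2 * q - 1], where [q' = q],
    once [E q (2 * q - 1) <= q] is known ([E_diag_le]).  On that diagonal (b)
    says nothing, but a little off it, (b) reflects [(q, 2 * q - 1 - d)] to
    [(q - d, 2 * q - 1 - d)], which is again close to the diagonal.  Moving off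
    the diagonal and back costs [2 * t * d <= d] by (a), and this is no more
    than the gain from replacing [q] by [q - d].  Hence one can descend along
    the diagonal in steps of length [d] to the point [(1, 1)], covered by (d),
    with a total error of only [t * d] ([E_diag_approx]); then [d] tends
    to 0. *)

Lemma theta_ge0 (R : realType) : 0 <= theta R.
Proof.
rewrite /theta; set A := (X in sup X).
(* [sup] is 0 by convention on sets that are empty or unbounded. *)
have [supA|supA] := pselect (has_sup A); last by rewrite sup_out.
have [[x Ax] ubA] := supA.
have x_ge0 : 0 <= x by case: Ax => q _ <-; exact: sqrtr_ge0.
exact: le_trans x_ge0 (ub_le_sup ubA Ax).
Qed.

Lemma Mstar_le (R : realType) (t q y b : R) :
  (Mstar t q y <= b) =
  [&& q <= b, 1 <= b, 1 + t * (y - 1) <= b & q + t * (1 + y - 2 * q) <= b].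
Proof. by rewrite /Mstar !ge_max. Qed.

Lemma Mstar_ge (R : realType) (t q y : R) :
  [/\ q <= Mstar t q y, 1 <= Mstar t q y, 1 + t * (y - 1) <= Mstar t q y
    & q + t * (1 + y - 2 * q) <= Mstar t q y].
Proof. by apply/and4P; rewrite -Mstar_le. Qed.

Lemma Mstar_nonneg_map (R : realType) (t : R) : nonneg_map (Mstar t).
Proof. by move=> q y _ _; have [_ M1 _ _] := Mstar_ge R t q y; lra. Qed.

Lemma Mstar_cond_a (R : realType) (t : R) : 0 <= t -> cond_a t (Mstar t).
Proof.
move=> t_ge0 q y z _ _ le_zy.
have tzy : 0 <= t * (y - z) by rewrite mulr_ge0// subr_ge0.
split; rewrite Mstar_le.
  by have [My1 My2 My3 My4] := Mstar_ge R t q y; apply/and4P; split; lra.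
by have [Mz1 Mz2 Mz3 Mz4] := Mstar_ge R t q z; apply/and4P; split; lra.
Qed.

Lemma Mstar_cond_b (R : realType) (t : R) : 0 <= t -> 2 * t <= 1 ->
  cond_b (Mstar t).
Proof.
move=> t_ge0 t_le_half /= q y y_ge0 q_ge0 q_le.
have [_ _ + _] := Mstar_ge R t (1 + y - q) y.
move: (Mstar t (1 + y - q) y) => M My.
rewrite Mstar_le !le_max !lexx My !orbT /=.
(* A convex combination of [q] and [1 + y - q] is at most their maximum. *)
have [le_q|lt_q] := leP q (1 + y - q).
  suff -> : q + t * (1 + y - 2 * q) <= 1 + y - q by rewrite !orbT.
  have : 0 <= (1 - t) * (1 + y - 2 * q) by apply: mulr_ge0; lra.
  lra.
suff -> : q + t * (1 + y - 2 * q) <= q by rewrite !orbT.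
have : 0 <= t * (2 * q - 1 - y) by apply: mulr_ge0; lra.
lra.
Qed.

Lemma Mstar_cond_c (R : realType) (t : R) : 0 <= t -> 2 * t <= 1 ->
  cond_c (Mstar t).
Proof.
move=> t_ge0 t_le_half /= q y q_ge0 y_ge0; rewrite Mstar_le.
have [q_le1|q_gt1] := leP q 1.
  have -> : Num.max 0 (q - 1) = 0 by apply/max_l; lra.
  move=> y_le0; have -> : y = 0 by lra.
  have : 0 <= (1 - 2 * t) * (1 - q) by apply: mulr_ge0; lra.
  by move=> ?; apply/and4P; split; lra.
have -> : Num.max 0 (q - 1) = q - 1 by apply/max_r; lra.
move=> y_le.
have ty : 0 <= t * (q - 1 - y) by apply: mulr_ge0; lra.
have tq : 0 <= t * (q - 1) by apply: mulr_ge0; lra.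
have tq' : 0 <= (1 - t) * (q - 1) by apply: mulr_ge0; lra.
by apply/and4P; split; lra.
Qed.

Lemma Mstar_cond_d (R : realType) (t : R) : 0 <= t -> 2 * t <= 1 ->
  cond_d (Mstar t).
Proof.
move=> t_ge0 t_le_half /= q y q_ge0 y_ge0; rewrite Mstar_le.
have [q_le1|q_gt1] := leP q 1 => ->.
  have : 0 <= (1 - 2 * t) * (1 - q) by apply: mulr_ge0; lra.
  by move=> ?; apply/and4P; split; lra.
have tq : 0 <= t * (q - 1) by apply: mulr_ge0; lra.
have tq' : 0 <= (1 - t) * (q - 1) by apply: mulr_ge0; lra.
by apply/and4P; split; lra.
Qed.

(** In the step from [p] to [p + d], the value that (b) reflects to is at most
    [p + 2 * t * d <= p + d] by induction and (a).  The previous error is thus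
    absorbed by the increase of the first coordinate, and only the last use of
    (a), back to the diagonal, leaves an error [t * d]. *)
Lemma E_diag_approx (R : realType) (t : R) (E : R -> R -> R) (d : R) (n : nat) :
  0 <= t -> 2 * t <= 1 -> cond_a t E -> cond_b E -> cond_d E ->
  0 <= d ->
  let q := 1 + n%:R * d in E q (2 * q - 1) <= q + t * d.
Proof.
move=> t_ge0 t_le_half Ea Eb Ed d_ge0 /=.
have td : 0 <= t * d by exact: mulr_ge0.
have td' : 0 <= (1 - 2 * t) * d by apply: mulr_ge0; lra.
elim: n => [|n IHn].
  rewrite mul0r addr0 mulr1.
  have -> : 2 - 1 = 1 :> R by lra.
  have : E 1 1 <= 1 by apply: Ed => //; rewrite maxxx.
  lra.
have nd : 0 <= n%:R * d by apply: mulr_ge0.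
have -> : 1 + n.+1%:R * d = 1 + n%:R * d + d by rewrite -(natr1 n); lra.
move: IHn; set p := 1 + n%:R * d => IHn.
have p_ge1 : 1 <= p by rewrite /p; lra.
move: p p_ge1 IHn => p p_ge1 IHn.
have [|||_ up] := Ea (p + d) (2 * (p + d) - 1) (2 * p + d - 1); [lra..|].
have [|||_ side] := Ea p (2 * p + d - 1) (2 * p - 1); [lra..|].
have : E (p + d) (2 * p + d - 1) <= p + d.
  apply: le_trans (Eb _ _ _ _ _) _; [lra..|].
  have -> : 1 + (2 * p + d - 1) - (p + d) = p by lra.
  by rewrite !ge_max; apply/and4P; split; lra.
lra.
Qed.

Lemma E_diag_le (R : realType) (t : R) (E : R -> R -> R) (q : R) :
  0 <= t -> 2 * t <= 1 -> cond_a t E -> cond_b E -> cond_d E ->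
  1 <= q -> E q (2 * q - 1) <= q.
Proof.
move=> t_ge0 t_le_half Ea Eb Ed q_ge1; apply/ler_addgt0Pr => e e_gt0.
(* The number of steps is chosen so that the step length is at most [e]. *)
pose n := Num.bound ((q - 1) / e).
have lt_n : (q - 1) / e < n.+1%:R.
  apply: (lt_trans (archi_boundP _)); first by apply: divr_ge0; lra.
  by rewrite ltr_nat.
pose d := (q - 1) / n.+1%:R.
have d_ge0 : 0 <= d by apply: divr_ge0 => //; lra.
have d_le : d <= e.
  by rewrite ler_pdivrMr ?ltr0n// mulrC -ler_pdivrMr// ltW.
have nd : 1 + n.+1%:R * d = q by rewrite mulrC divfK ?pnatr_eq0//; lra.
have := E_diag_approx R t E d n.+1 t_ge0 t_le_half Ea Eb Ed d_ge0.
rewrite /= nd => /le_trans; apply.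
have : 0 <= (1 - t) * d by apply: mulr_ge0; lra.
lra.
Qed.

Lemma E_le_Mstar (R : realType) (t : R) (E : R -> R -> R) (q y : R) :
  0 <= t -> 2 * t <= 1 -> cond_a t E -> cond_b E -> cond_d E ->
  0 <= q -> 0 <= y -> E q y <= Mstar t q y.
Proof.
move=> t_ge0 t_le_half Ea Eb Ed q_ge0 y_ge0.
have [Mq M1 My Mqy] := Mstar_ge R t q y.
have [q_le1|/ltW q_ge1] := leP q 1.
  have E1 : E q 1 <= 1 by apply: Ed => //; rewrite max_r.
  have [y_le1|/ltW y_ge1] := leP y 1.
    by have [Ey _] := Ea _ _ _ q_ge0 y_ge0 y_le1; lra.
  by have [_ Ey] := Ea _ _ _ q_ge0 ler01 y_ge1; lra.
have Eq := E_diag_le R t E q t_ge0 t_le_half Ea Eb Ed q_ge1.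
have [y_le|/ltW y_ge] := leP y (2 * q - 1).
  by have [Ey _] := Ea _ _ _ q_ge0 y_ge0 y_le; lra.
have diag_ge0 : 0 <= 2 * q - 1 by lra.
by have [_ Ey] := Ea _ _ _ q_ge0 diag_ge0 y_ge; lra.
Qed.

(* The hypothesis on theta is the Kim-Sarnak bound. *)
Theorem propositionA2 (R : realType) (theta_le : theta R <= 7 / 32) :
  (nonneg_map (Mstar (theta R)) /\ conds_ad (theta R) (Mstar (theta R))) /\
  (forall E : R -> R -> R, nonneg_map E -> conds_ad (theta R) E ->
     forall q y : R, 0 <= q -> 0 <= y -> E q y <= Mstar (theta R) q y).
Proof.
have t_ge0 := theta_ge0 R.
have t_le_half : 2 * theta R <= 1 by lra.
split; last by move=> E _ [Ea Eb _ Ed] q y; exact: E_le_Mstar.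
split; first exact: Mstar_nonneg_map.
split; [exact: Mstar_cond_a|exact: Mstar_cond_b|exact: Mstar_cond_c|].
exact: Mstar_cond_d.
Qed.
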